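(* Let $G$ be a two-player normal-form game and $c>0$ a simulation cost. Identify a mixed strategy profile $\sigma=(\sigma_1,\sigma_2)$ of $G$ with the profile $(\sigma_1,\widehat{\sigma}_2)$ of the mixed-strategy simulation game $G_{\text{m-sim}}=G^c_{\text{m-sim}}$, where $\widehat\sigma_2$ is the strategy of player 2 in $G_{\text{m-sim}}$ that puts all probability mass on the single element $\sigma_2\in\Sigma_2$. Then $\mathrm{NE}(G)\subseteq\mathrm{NE}(G_{\text{m-sim}})$.
   Context: A two-player normal-form game (NFG) $G=(S_1,S_2,u)$ has nonempty pure strategy sets (finite unless stated otherwise) and $u=(u_1,u_2):S_1\times S_2\to\mathbb R^2$. $\Sigma_i=\Delta(S_i)$, $u$ is extended by expectation, $\mathrm{NE}(G)$ is the set of Nash equilibria. For $\sigma_2\in\Sigma_2$, $\mathrm{br}(\sigma_2)\subseteq S_1$ is the set of pure best responses of player 1 and $\text{f-br}(\sigma_2)=\arg\max_{t_1\in \mathrm{br}(\sigma_2)}u_2(t_1,\sigma_2)$. For a simulation cost $c>0$, the mixed-strategy simulation game $G^c_{\text{m-sim}}$ is the (infinite) NFG in which player 1's pure strategies are $S_1\cup\{\text{m-sim}\}$, player 2's pure strategies are $\Sigma_2$ (all mixed strategies of player 2 in $G$), $u(s_1,\sigma_2)$ is as in $G$ for $s_1\in S_1$, and $$u_1(\text{m-sim},\sigma_2)=u_1(\mathrm{br}(\sigma_2),\sigma_2)-c,\qquad u_2(\text{m-sim},\sigma_2)=u_2(\text{f-br}(\sigma_2),\sigma_2).$$ Mixed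 strategies of player 2 in $G^c_{\text{m-sim}}$ are (Borel) probability distributions over $\Sigma_2$; Nash equilibria are defined as usual. *)

(* Defs.v *)
From HB Require Import structures.
From mathcomp Require Import all_boot all_order all_algebra.
From mathcomp Require Import all_classical all_reals all_analysis.

Set Implicit Arguments.
Unset Strict Implicit.
Unset Printing Implicit Defensive.

Import Order.TTheory GRing.Theory Num.Theory.
Import numFieldNormedType.Exports.

Local Open Scope classical_set_scope.
Local Open Scope ring_scope.

Record nfg (R : realType) := NFG {
  strat1 : finType;
  strat2 : finType;
  strat1_gt0 : (0 < #|strat1|)%N;
  strat2_gt0 : (0 < #|strat2|)%N;
  u1 : strat1 -> strat2 -> R;
  u2 : strat1 -> strat2 -> R }.

Arguments u1 {R} G _ _ : rename.
Arguments u2 {R} G _ _ : rename.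

(* [{ptws S -> R}] is the function space [S -> R] with the product topology,
   i.e. the Euclidean topology of R^S since S is finite. *)
Definition simplex (R : realType) (S : finType) : set {ptws S -> R} :=
  [set x | (forall s, 0 <= x s) /\ \sum_s x s = 1].

Definition mixed (R : realType) (S : finType) : topologicalType :=
  set_type (@simplex R S).

Definition prob (R : realType) (S : finType) (x : mixed R S) : S -> R :=
  set_val x.

Definition Sigma1 (R : realType) (G : nfg R) := mixed R (strat1 G).
Definition Sigma2 (R : realType) (G : nfg R) := mixed R (strat2 G).

Section point_mass.
Variables (R : realType) (S : finType) (s0 : S).

Let pure_fun (s : S) : R := (s == s0)%:R.

Let pure_simplex : pure_fun \in @simplex R S.
Proof.
apply/mem_set; split=> [s|]; first by rewrite /pure_fun ler0n.
rewrite (bigD1 s0)//= /pure_fun eqxx big1 ?addr0// => s /negPf ->.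
by [].
Qed.

Definition pure : mixed R S := exist _ pure_fun pure_simplex.

End point_mass.

Section game.
Variables (R : realType) (G : nfg R).

Definition pureval (u : strat1 G -> strat2 G -> R)
    (s1 : strat1 G) (x2 : Sigma2 G) : R :=
  \sum_s2 prob x2 s2 * u s1 s2.

Definition mixedval (u : strat1 G -> strat2 G -> R)
    (x1 : Sigma1 G) (x2 : Sigma2 G) : R :=
  \sum_s1 prob x1 s1 * pureval u s1 x2.

Definition br (x2 : Sigma2 G) : {set strat1 G} :=
  [set s1 | [forall t1, pureval (u1 G) t1 x2 <= pureval (u1 G) s1 x2]].

Definition fbr (x2 : Sigma2 G) : {set strat1 G} :=
  [set t1 in br x2 |
    [forall (s1 | s1 \in br x2),
      pureval (u2 G) s1 x2 <= pureval (u2 G) t1 x2]].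

End game.

(* The common value on A of a function f that is constant on A. In the payoffs
   below A is nonempty and f is constant on A (see [br_value], [fbr_value]). *)
Definition value_on (R : realType) (S : finType) (A : {set S}) (f : S -> R) :=
  if [pick s in A] is Some s then f s else 0.

(* Nash equilibria of a two-player game with mixed strategy sets M1, M2 and
   expected payoffs U1, U2. *)
Definition nash (R : realType) (M1 M2 : Type) (U1 U2 : M1 -> M2 -> R) :
    set (M1 * M2) :=
  [set m | (forall m1, U1 m1 m.2 <= U1 m.1 m.2) /\
           (forall m2, U2 m.1 m2 <= U2 m.1 m.2)].

Definition NE (R : realType) (G : nfg R) : set (Sigma1 G * Sigma2 G) :=
  nash (mixedval (u1 G)) (mixedval (u2 G)).

Arguments NE {R} G _.

Section value_lemmas.
Variables (R : realType) (G : nfg R) (x2 : Sigma2 G).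

Lemma br_neq0 : exists s1, s1 \in br x2.
Proof.
have [s0 _] := card_gt0P (strat1_gt0 G).
case: (arg_maxP (fun s => pureval (u1 G) s x2) (erefl : xpredT s0)).
by move=> s _ smax; exists s; rewrite inE; apply/forallP => t; exact: smax.
Qed.

Lemma fbr_neq0 : exists s1, s1 \in fbr x2.
Proof.
have [s0 s0br] := br_neq0.
case: (arg_maxP (fun s => pureval (u2 G) s x2) s0br) => s sbr smax.
exists s; rewrite /fbr finset.in_set; apply/andP; split=> //.
by apply/forall_inP => t; exact: smax.
Qed.

Lemma br_value (s1 : strat1 G) : s1 \in br x2 ->
  value_on (br x2) (fun t => pureval (u1 G) t x2) = pureval (u1 G) s1 x2.
Proof.
move=> s1br; rewrite /value_on; case: pickP => [t tbr|/(_ s1)]; last first.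
  by rewrite s1br.
move: s1br tbr; rewrite !inE => /forallP s1max /forallP tmax.
by apply/eqP; rewrite eq_le s1max tmax.
Qed.

Lemma fbr_value (s1 : strat1 G) : s1 \in fbr x2 ->
  value_on (fbr x2) (fun t => pureval (u2 G) t x2) = pureval (u2 G) s1 x2.
Proof.
move=> s1f; rewrite /value_on; case: pickP => [t tf|/(_ s1)]; last first.
  by rewrite s1f.
move: s1f tf; rewrite /fbr !(finset.in_set (fun t => (t \in br x2) && _)).
move=> /andP[sbr /forall_inP smax] /andP[tbr /forall_inP tmax].
by apply/eqP; rewrite eq_le smax// tmax.
Qed.

End value_lemmas.

Section msim.
Variables (R : realType) (G : nfg R).

(* [measurableType]s are required to be pointed; the choice of the point plays
   no role in what follows. *)
HB.instance Definition _ := Topological.on (Sigma2 G).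
HB.instance Definition _ :=
  isPointed.Build (Sigma2 G) (pure R (enum_val (Ordinal (strat2_gt0 G)))).

Definition borelSigma2 : measurableType _ :=
  g_sigma_algebraType (@open (Sigma2 G)).

(* [None] is the pure strategy m-sim. *)
Definition msim_strat1 : finType := option (strat1 G).

Definition msim_u1 (c : R) (a : msim_strat1) (x2 : Sigma2 G) : R :=
  match a with
  | Some s1 => pureval (u1 G) s1 x2
  | None => value_on (br x2) (fun t1 => pureval (u1 G) t1 x2) - c
  end.

Definition msim_u2 (a : msim_strat1) (x2 : Sigma2 G) : R :=
  match a with
  | Some s1 => pureval (u2 G) s1 x2
  | None => value_on (fbr x2) (fun t1 => pureval (u2 G) t1 x2)
  end.

Definition msim_Sigma1 := mixed R msim_strat1.
Definition msim_Sigma2 := probability borelSigma2 R.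

Definition msim_mixedval (v : msim_strat1 -> Sigma2 G -> R)
    (p : msim_Sigma1) (mu : msim_Sigma2) : R :=
  \sum_a prob p a * \int[mu]_(x2 in [set: borelSigma2]) v a x2.

Definition NE_msim (c : R) : set (msim_Sigma1 * msim_Sigma2) :=
  nash (msim_mixedval (msim_u1 c)) (msim_mixedval msim_u2).

Section embed1.
Variable x1 : Sigma1 G.

Let embed1_fun (a : msim_strat1) : R := if a is Some s1 then prob x1 s1 else 0.

Let embed1_simplex : embed1_fun \in @simplex R msim_strat1.
Proof.
have [x1_ge0 x1_1] := set_valP x1.
apply/mem_set; split=> [[s|]//=|]; first exact: x1_ge0.
rewrite (bigD1 None)//= add0r (reindex_omap Some id)/=; last by case.
by rewrite -[RHS]x1_1; apply: eq_bigl => s; rewrite eqxx.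
Qed.

Definition embed1 : msim_Sigma1 := exist _ embed1_fun embed1_simplex.

End embed1.

Definition embed2 (x2 : Sigma2 G) : msim_Sigma2 :=
  @dirac _ borelSigma2 x2 R.

Definition embed (x : Sigma1 G * Sigma2 G) : msim_Sigma1 * msim_Sigma2 :=
  (embed1 x.1, embed2 x.2).

End msim.

Arguments NE_msim {R} G c _.

(* Main.v *)
(** A deviation of player 1 in the simulation game is a mixture of deviations
    already available in [G] and of m-sim, which against a fixed [x2] earns the
    best-response value minus [c]; so it cannot be profitable.  A deviation
    [mu] of player 2 earns the [mu]-average of [mixedval (u2 G) x1], which is
    bounded by its maximum, attained at [x2].  The payoff of player 2 at m-sim
    is irrelevant since [embed1 x1] gives m-sim probability 0. *)
Require Import Defs.
From mathcomp Require Import all_boot all_order all_algebra.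
From mathcomp Require Import all_classical all_reals all_analysis.
From mathcomp Require Import measurable_realfun.

Set Implicit Arguments.
Unset Strict Implicit.
Unset Printing Implicit Defensive.

Import Order.TTheory GRing.Theory Num.Theory.
Import numFieldNormedType.Exports.

Local Open Scope classical_set_scope.
Local Open Scope ring_scope.

Lemma prob_ge0 (R : realType) (S : finType) (x : mixed R S) (s : S) :
  0 <= prob x s.
Proof. by have [+ _] := set_valP x; apply. Qed.

Lemma prob_sum1 (R : realType) (S : finType) (x : mixed R S) :
  \sum_s prob x s = 1.
Proof. by have [_] := set_valP x. Qed.

Lemma prob_le1 (R : realType) (S : finType) (x : mixed R S) (s : S) :
  prob x s <= 1.
Proof.
rewrite -(prob_sum1 x) (bigD1 s)//= lerDl.
by apply: sumr_ge0 => t _; exact: prob_ge0.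
Qed.

Lemma prob_mean_le (R : realType) (S : finType) (x : mixed R S) (f : S -> R)
    (M : R) : (forall s, f s <= M) -> \sum_s prob x s * f s <= M.
Proof.
move=> fM; rewrite -[leRHS]mul1r -(prob_sum1 x) mulr_suml.
by apply: ler_sum => s _; rewrite ler_wpM2l// prob_ge0.
Qed.

Lemma sum_option (V : nmodType) (T : finType) (F : option T -> V) :
  \sum_a F a = F None + \sum_s F (Some s).
Proof.
rewrite (bigD1 None)//=; congr (_ + _).
rewrite (reindex_omap Some id)/=; last by case.
by apply: eq_bigl => s; rewrite eqxx.
Qed.

Lemma mixedval_pure (R : realType) (G : nfg R)
    (u : strat1 G -> strat2 G -> R) (s1 : strat1 G) (x2 : Sigma2 G) :
  mixedval u (pure R s1) x2 = pureval u s1 x2.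
Proof.
rewrite /mixedval (bigD1 s1)//= [X in X * _](_ : _ = 1); last first.
  by rewrite /prob set_valE/= eqxx.
rewrite mul1r big1 ?addr0// => t /negPf ts.
by rewrite /prob set_valE/= ts mul0r.
Qed.

(** The set [br x2] changes with [x2], so measurability of the best-response value is not visible
    from [value_on]; as a finite maximum it is. The seed at [s0] is itself one of the values
    compared, so it does not alter the maximum. *)
Lemma br_value_bigmax (R : realType) (G : nfg R) (s0 : strat1 G)
    (x2 : Sigma2 G) :
  value_on (br x2) (fun t => pureval (u1 G) t x2) =
  \big[Num.max/pureval (u1 G) s0 x2]_t pureval (u1 G) t x2.
Proof.
have [s sbr] := br_neq0 x2; rewrite (br_value sbr).
move: sbr; rewrite inE => /forallP smax; apply/eqP; rewrite eq_le.
by rewrite le_bigmax//=; apply: bigmax_le.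
Qed.

Lemma measurable_bigmaxr (d : measure_display) (T : measurableType d)
    (R : realType) (D : set T) (I : Type) (r : seq I) (g : T -> R)
    (f : I -> T -> R) :
  measurable_fun D g -> (forall i, measurable_fun D (f i)) ->
  measurable_fun D (fun x => \big[Num.max/g x]_(i <- r) f i x).
Proof.
move=> mg mf; elim: r => [|i r ih]; first by under eq_fun do rewrite big_nil.
under eq_fun do rewrite big_cons.
exact: measurable_maxr.
Qed.

(** The simplex carries the initial topology of its inclusion into the product space, and a
    coordinate is a projection after that inclusion. *)
Lemma prob_continuous (R : realType) (S : finType) (s : S) :
  continuous (fun x : mixed R S => prob x s).
Proof.
move=> x; apply: (@continuous_comp _ _ _ _ (fun f : {ptws S -> R} => f s)).
  exact: initial_continuous.
exact: (@proj_continuous _ (fun=> R) s).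
Qed.

Lemma measurable_prob (R : realType) (G : nfg R) (s : strat2 G) :
  measurable_fun [set: borelSigma2 G] (fun x : borelSigma2 G => prob x s).
Proof.
(* The open rays above [y] generate the Borel sets of the reals; their preimages are open by
   continuity, hence among the generators of [borelSigma2]. *)
apply: (measurability _ (RGenOInfty.measurableE R)) => _ [_ [y ->] <-].
rewrite setTI; apply: sub_sigma_algebra.
have /continuousP := @prob_continuous R (strat2 G) s; apply.
exact: interval_open.
Qed.

Lemma measurable_pureval (R : realType) (G : nfg R)
    (u : strat1 G -> strat2 G -> R) (s1 : strat1 G) :
  measurable_fun [set: borelSigma2 G] (pureval u s1).
Proof.
apply: measurable_sum => s2; apply: measurable_funM => //.
exact: measurable_prob.
Qed.

Lemma normr_pureval_le (R : realType) (G : nfg R)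
    (u : strat1 G -> strat2 G -> R) (s1 : strat1 G) (x2 : Sigma2 G) :
  `|pureval u s1 x2| <= \sum_s2 `|u s1 s2|.
Proof.
apply: (le_trans (ler_norm_sum _ _ _)); apply: ler_sum => s2 _.
by rewrite normrM ler_piMl// ger0_norm ?prob_ge0 ?prob_le1.
Qed.

(** A measurable function bounded uniformly in [x2] is integrable for a probability; this licenses
    linearity and monotonicity of the integral below. *)
Lemma integrable_pureval (R : realType) (G : nfg R)
    (u : strat1 G -> strat2 G -> R) (s1 : strat1 G) (mu : msim_Sigma2 G) :
  mu.-integrable [set: borelSigma2 G] (EFin \o pureval u s1).
Proof.
apply: measurable_bounded_integrable => //.
- by rewrite [X in (X < _)%E](probability_setT mu) ltry.
- exact: measurable_pureval.
exists (\sum_s2 `|u s1 s2|); split; first exact: num_real.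
by move=> M /ltW leM x _; apply: le_trans leM; exact: normr_pureval_le.
Qed.

Lemma measurable_msim_u1 (R : realType) (G : nfg R) (c : R)
    (a : msim_strat1 G) :
  measurable_fun [set: borelSigma2 G] (msim_u1 c a).
Proof.
case: a => [s1|]; first exact: measurable_pureval.
have [s0 _] := card_gt0P (strat1_gt0 G).
apply: measurable_funB => //.
under eq_fun do rewrite (br_value_bigmax s0).
by apply: measurable_bigmaxr => [|t]; exact: measurable_pureval.
Qed.

Lemma Rintegral_embed2 (R : realType) (G : nfg R) (x2 : Sigma2 G)
    (f : borelSigma2 G -> R) : measurable_fun [set: borelSigma2 G] f ->
  \int[embed2 x2]_(x in [set: borelSigma2 G]) f x = f x2.
Proof.
move=> mf; rewrite /Rintegral integral_dirac//; last exact/measurable_EFinP.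
by rewrite diracT mul1e.
Qed.

Lemma msim_mixedval_embed1 (R : realType) (G : nfg R)
    (v : msim_strat1 G -> Sigma2 G -> R) (x1 : Sigma1 G) (mu : msim_Sigma2 G) :
  msim_mixedval v (embed1 x1) mu =
  \sum_s1 prob x1 s1 * \int[mu]_(x in [set: borelSigma2 G]) v (Some s1) x.
Proof.
by rewrite /msim_mixedval sum_option {1}/prob set_valE/= mul0r add0r.
Qed.

(** The finite mixture over [s1] moves under the integral, where the pointwise bound applies. *)
Lemma Rintegral_mixedval_le (R : realType) (G : nfg R)
    (u : strat1 G -> strat2 G -> R) (x1 : Sigma1 G) (mu : msim_Sigma2 G)
    (M : R) : (forall x2, mixedval u x1 x2 <= M) ->
  \sum_s1 prob x1 s1 * \int[mu]_(x in [set: borelSigma2 G]) pureval u s1 x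
    <= M.
Proof.
move=> leM.
have iu s1 : mu.-integrable [set: borelSigma2 G]
    (fun x => (prob x1 s1 * pureval u s1 x)%:E).
  by under eq_fun do rewrite EFinM;
    apply: integrableZl => //; exact: integrable_pureval.
have iM : mu.-integrable [set: borelSigma2 G] (EFin \o cst M).
  exact: finite_measure_integrable_cst.
have imix : mu.-integrable [set: borelSigma2 G] (EFin \o mixedval u x1).
  rewrite (_ : _ \o _ = fun x => (\sum_s1 (prob x1 s1 * pureval u s1 x)%:E)%E).
    exact: integrable_sum.
  by apply/funext => x /=; rewrite sumEFin.
(* Total mass 1 turns the bound into an integral, so that monotonicity can compare the two. *)
have -> : M = \int[mu]_(x in [set: borelSigma2 G]) M.
  rewrite Rintegral_cst//.
  by rewrite [X in fine X](probability_setT mu) mulr1.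
apply: (@le_trans _ _
    (\int[mu]_(x in [set: borelSigma2 G]) mixedval u x1 x)); last first.
  by apply: le_Rintegral => // x _; exact: leM.
(* Sum and integral are exchanged in the extended reals; [fine] then passes through the sum because
   each integral is finite. *)
rewrite {2}/Rintegral; under [in leRHS]eq_integral do rewrite -sumEFin.
rewrite integral_sum// -sum_fine; last first.
  by move=> s1 _; exact: integrable_fin_num.
apply: ler_sum => s1 _; rewrite -RintegralZl//.
exact: integrable_pureval.
Qed.

Theorem lemma3p2 (R : realType) (G : nfg R) (c : R) (c_gt0 : 0 < c) :
  [set embed x | x in NE G] `<=` NE_msim G c.
Proof.
move=> _ [[x1 x2] [/= ne1 ne2] <-].
have dev1 s : pureval (u1 G) s x2 <= mixedval (u1 G) x1 x2.
  (* The equilibrium condition [ne1] is applied to the deviation [pure R s]. *)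
  by rewrite -mixedval_pure.
split=> [p|mu] /=; rewrite msim_mixedval_embed1.
- under [leRHS]eq_bigr do rewrite (Rintegral_embed2 _ (measurable_msim_u1 c _)).
  apply: prob_mean_le => a; rewrite (Rintegral_embed2 _ (measurable_msim_u1 c _)).
  case: a => [s|] /=; first exact: dev1.
  have [s sbr] := br_neq0 x2; rewrite (br_value sbr).
  (* At m-sim, dropping the positive cost leaves the payoff of the best response [s], already
     bounded by [dev1]. *)
  by apply: le_trans (dev1 s); rewrite gerBl ltW.
- rewrite msim_mixedval_embed1.
  under [leRHS]eq_bigr do rewrite (Rintegral_embed2 _ (measurable_pureval _ _)).
  exact: Rintegral_mixedval_le ne2.
Qed.
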